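(* Let $W$ be a real-valued random variable with mean zero and finite variance $\sigma^2$, and let $W^\star$ be a random variable, defined on the same probability space as $W$, having the $W$-zero-biased distribution. Then $$\mathrm{Var}[g(W)]\leq\sigma^2\,\mathbb{E}\left[g'(W)^2\right]+2\sigma^2\,\|g'g''\|\,\mathbb{E}|W^\star-W|$$ for all twice differentiable functions $g:\mathbb{R}\to\mathbb{R}$ for which $\mathrm{Var}[g(W)]$ exists (is finite).
   Context: For a real-valued random variable $W$ with mean zero and finite variance $\sigma^2$, a random variable $W^\star$ is said to have the $W$-zero-biased distribution if $$\mathbb{E}[W\phi(W)]=\sigma^2\,\mathbb{E}[\phi'(W^\star)]$$ for all absolutely continuous functions $\phi:\mathbb{R}\to\mathbb{R}$ for which the expectations exist. (Such a $W^\star$ always exists and its law is unique.) Here $\|\cdot\|$ denotes the supremum norm, so $\|g'g''\|=\sup_{x\in\mathbb{R}}|g'(x)g''(x)|$. The right-hand side of the bound may be infinite, in which case it is trivial. *)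

(* Defs.v *)
From HB Require Import structures.
From mathcomp Require Import all_boot all_order all_algebra.
From mathcomp Require Import all_classical all_reals all_analysis.

Set Implicit Arguments.
Unset Strict Implicit.
Unset Printing Implicit Defensive.

Import Order.TTheory GRing.Theory Num.Theory.
Import numFieldNormedType.Exports.

Local Open Scope classical_set_scope.
Local Open Scope ring_scope.

(* The intervals ]u i, v i[ are pairwise disjoint subintervals of [a, b];
   degenerate (empty) ones are allowed and contribute 0 to both sums. *)
Definition abs_continuous_on (R : realType) (a b : R) (f : R -> R) : Prop :=
  forall e : R, 0 < e -> exists2 d : R, 0 < d &
    forall (n : nat) (u v : 'I_n -> R),
      (forall i, [/\ a <= u i, u i <= v i & v i <= b]) ->
      trivIset [set: 'I_n] (fun i => `]u i, v i[%classic) ->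
      \sum_(i < n) (v i - u i) < d ->
      \sum_(i < n) `|f (v i) - f (u i)| < e.

(* Absolute continuity on the whole line is meant on every compact interval,
   so that, for example, polynomials qualify. *)
Definition abs_continuous (R : realType) (f : R -> R) : Prop :=
  forall a b : R, a <= b -> abs_continuous_on a b f.

(* An absolutely continuous phi is differentiable only almost everywhere, and
   phi^`() takes a default value elsewhere. This is harmless: when 'V_P[W] > 0
   a zero-biased law has a Lebesgue density, and when 'V_P[W] = 0 the condition
   holds for every Wstar. The expectations "exist" when both are finite. *)
Definition zero_biased d (T : measurableType d) (R : realType)
    (P : probability T R) (W Wstar : {RV P >-> R}) : Prop :=
  forall phi : R -> R, abs_continuous phi ->
    (fun w => W w * phi (W w)) \in Lfun P 1%E ->
    (fun w => phi^`()%classic (Wstar w)) \in Lfun P 1%E ->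
    ('E_P[(fun w => W w * phi (W w))%R]
     = 'V_P[W] * 'E_P[(fun w => phi^`()%classic (Wstar w))%R])%E.

Definition sup_norm (R : realType) (f : R -> R) : \bar R :=
  ereal_sup [set (`|f x|)%:E | x in [set: R]].

(* Main.v *)
Require Import Defs.
From HB Require Import structures.
From mathcomp Require Import all_boot all_order all_algebra.
From mathcomp Require Import all_classical all_reals all_analysis.
From mathcomp Require Import measurable_realfun ring lra.
Import Order.TTheory GRing.Theory Num.Theory.
Import numFieldNormedType.Exports.
Local Open Scope ring_scope.

(** Write V for the variance of W and W' for the zero-biased variable. The
    bound splits into two inequalities:
[[
      Var g(W) <= V * E[g'(W')^2],
      g'(y)^2 <= g'(x)^2 + 2 ||g'g''|| |y - x|.
]]
    The first ([zero_biased_variance_le]) is the Poincare inequality of a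
    zero-biased pair. If F is the primitive of g'^2 with F(0) = 0, then
    Cauchy-Schwarz gives (g(x) - g(0))^2 <= x F(x) ([sqr_increment_le]), hence
    Var g(W) <= E[(g(W) - g(0))^2] <= E[W F(W)] = V * E[g'(W')^2], the last
    step being the defining identity of W' for phi = F. The second
    ([sqr_derive1_increment_le]) holds because (g'^2)' = 2 g'g''; taking
    x = W, y = W' and integrating gives the theorem when ||g'g''|| is finite.

    The defining identity is only available when both expectations exist, which
    may fail for F: neither W F(W) nor g'(W')^2 need be integrable. So g'^2 is
    first multiplied by a continuous cutoff [tent n], equal to 1 on [-n, n] and
    to 0 outside [-n-1, n+1]. The primitive of the product is bounded and has a
    bounded derivative, so the identity applies to it
    ([zero_biased_primitive]), and the Cauchy-Schwarz bound still holds for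
    |x| <= n. Dropping the cutoff on the right-hand side and letting n tend to
    infinity on the left gives the first inequality in the extended reals,
    without integrability conditions.

    If ||g'g''|| is infinite, so is the right-hand side, unless V = 0 or
    E|W' - W| = 0, since 0 * oo = 0. If V = 0, the first inequality suffices. If
    E|W' - W| = 0, then W' = W almost surely and the first inequality is already
    the claim; when V > 0, W is then Gaussian and this is the Gaussian Poincare
    inequality. *)

(** * Differentiable functions on the line *)

Lemma derivable1_continuous {R : realType} {f : R -> R} :
  (forall x, derivable f x 1) -> continuous f.
Proof. by move=> df x; apply/differentiable_continuous/derivable1_diffP. Qed.

Lemma MVT_derive1 {R : realType} {f : R -> R} {x y : R} :
  (forall z, derivable f z 1) -> x <= y ->
  exists c, f y - f x = f^`()%classic c * (y - x).
Proof.
move=> df xy.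
have [z _||c _ ->] := @MVT_segment R f f^`()%classic x y xy.
- by rewrite derive1E; apply/derivableP.
- exact/continuous_subspaceT/derivable1_continuous.
- by exists c.
Qed.

Lemma derivable_lipschitz {R : realType} {f : R -> R} {M : R} :
    (forall x, derivable f x 1) -> (forall x, `|f^`()%classic x| <= M) ->
  forall x y, `|f y - f x| <= M * `|y - x|.
Proof.
move=> df f'M x y; wlog xy : x y / x <= y.
  move=> H; have [/H//|/ltW/H] := leP x y.
  by rewrite distrC [in X in _ <= X]distrC.
have [c ->] := MVT_derive1 df xy.
by rewrite normrM ler_wpM2r.
Qed.

Lemma lipschitz_abs_continuous {R : realType} {f : R -> R} {M : R} :
  (forall x y, `|f y - f x| <= M * `|y - x|) -> abs_continuous f.
Proof.
move=> fM a b _ e e0.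
have M0 : 0 < `|M| + 1 by rewrite ltr_wpDl.
exists (e / (`|M| + 1)); first exact: divr_gt0.
move=> n u v uv _; rewrite ltr_pdivlMr// mulrC; apply: le_lt_trans.
rewrite mulr_sumr; apply: ler_sum => i _; apply: (le_trans (fM _ _)).
have [_ uvi _] := uv i; rewrite ger0_norm ?subr_ge0//.
rewrite ler_wpM2r ?subr_ge0//.
by rewrite (le_trans (ler_norm M))// lerDl.
Qed.

(** Cauchy-Schwarz for g(x) - g(0), the integral of g' over [0, x], without
    integrals: whatever the slope s, (g' - s)^2 >= 0 makes
    h(z) = F(z) - 2 s g(z) + s^2 z nondecreasing between 0 and x, so
    x (h(x) - h(0)) >= 0; the mean slope s is the optimal choice. *)
Lemma sqr_increment_le {R : realType} {g F : R -> R} {x : R} :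
    (forall z, derivable g z 1) -> (forall z, derivable F z 1) ->
    F 0 = 0 ->
    (forall z, `|z| <= `|x| -> g^`()%classic z ^+ 2 <= F^`()%classic z) ->
  (g x - g 0) ^+ 2 <= x * F x.
Proof.
move=> dg dF F0 gF.
have [->|x0] := eqVneq x 0; first by rewrite subrr mul0r expr0n.
(* With this s, x (h(x) - h(0)) is exactly x F(x) - (g(x) - g(0))^2. *)
pose s := (g x - g 0) / x.
pose h z := F z - (2 * s) *: g z + s ^+ 2 *: z.
have dh (z : R) : is_derive z 1 h
    (F^`()%classic z - (2 * s) * g^`()%classic z + s ^+ 2).
  have := derivableP (dg z); have := derivableP (dF z).
  rewrite -!derive1E => ? ?.
  rewrite /h; apply: is_derive_eq.
  by rewrite /GRing.scale/= mulr1.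
have h'0 z : `|z| <= `|x| ->
    0 <= F^`()%classic z - (2 * s) * g^`()%classic z + s ^+ 2.
  move=> /gF; have := sqr_ge0 (g^`()%classic z - s).
  rewrite sqrrB; lra.
have ch : continuous h by apply: derivable1_continuous => z; apply: ex_derive.
have hx : 0 <= x * (h x - h 0).
  have [xgt0|xle0] := ltP 0 x.
    have [|c cx ->] := @MVT_segment R h _ 0 x (ltW xgt0) (fun z _ => dh z).
      exact: continuous_subspaceT.
    rewrite subr0 mulrCA; apply: mulr_ge0; last by rewrite mulr_ge0 ?ltW.
    apply: h'0.
    by move: cx; rewrite in_itv/= => /andP[c0 cx]; rewrite !ger0_norm// ltW.
  have [|c cx hE] := @MVT_segment R h _ x 0 xle0 (fun z _ => dh z).
    exact: continuous_subspaceT.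
  have -> : x * (h x - h 0) = (- x) * (h 0 - h x) by ring.
  rewrite hE sub0r mulrCA; apply: mulr_ge0; last by rewrite mulr_ge0 ?oppr_ge0.
  apply: h'0.
  by move: cx; rewrite in_itv/= => /andP[xc c0]; rewrite !ler0_norm// lerN2.
rewrite -subr_ge0; suff <- : x * (h x - h 0) = x * F x - (g x - g 0) ^+ 2 by [].
rewrite /h /s F0 /GRing.scale/=; field.
exact: x0.
Qed.

Lemma sqr_derive1_increment_le {R : realType} {h : R -> R} {K : R} :
    (forall x, derivable h x 1) -> (forall x, `|h x * h^`()%classic x| <= K) ->
  forall x y, h y ^+ 2 <= h x ^+ 2 + 2 * K * `|y - x|.
Proof.
move=> dh hK x y; rewrite -lerBlDl; apply: le_trans (ler_norm _) _.
have dh2 (z : R) : is_derive z 1 (fun x => h x ^+ 2)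
    (2 * (h z * h^`()%classic z)).
  have := derivableP (dh z); rewrite -derive1E => ?.
  apply: is_derive_eq; rewrite /GRing.scale/=; ring.
apply: (@derivable_lipschitz R (fun x => h x ^+ 2)).
  by move=> z; have [] := dh2 z.
move=> z; rewrite derive1E derive_val normrM ger0_norm//.
by rewrite ler_pM2l.
Qed.

(** * Bounded primitives of cut-off functions *)

(** The primitive is the integral over the half-line up to x, renormalized at
    0; being between 0 and the total integral of f, it is bounded. *)
Lemma bounded_primitive {R : realType} (f : R -> R) (a : R) :
    continuous f -> (forall x, 0 <= f x) -> (forall x, a < `|x| -> f x = 0) ->
  exists2 F : R -> R, (forall x, derivable F x 1) &
    [/\ F^`()%classic = f, F 0 = 0 & exists M : R, forall x, `|F x| <= M].
Proof.
move=> cf f0 fa.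
pose mu := @lebesgue_measure R.
have intf : mu.-integrable setT (EFin \o f).
  have -> : EFin \o f = (EFin \o f) \_ `[- a, a]%classic.
    apply/funext => x; rewrite patchE; case: ifPn => //.
    rewrite notin_setE/= in_itv/= => /negP.
    by rewrite -ler_norml -ltNge => /fa ->.
  apply: (integrable_mkcond _ _).1 => //.
  apply: continuous_compact_integrable; first exact: segment_compact.
  exact: continuous_subspaceT.
have intfS A : measurable A -> mu.-integrable A (EFin \o f).
  by move=> mA; exact: integrableS intf.
pose F x := (\int[mu]_(t in `]-oo, x]) f t)%R.
have dF x : derivable F x 1 /\ F^`()%classic x = f x.
  apply: (@continuous_FTC1 R f -oo%O x (x + 1)) => //.
  - by rewrite ltrDl.
  - exact: intfS.
  - by rewrite ltNyr.
  - exact: cf.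
pose C := (\int[mu]_t f t)%R.
have FC x : 0 <= F x <= C.
  apply/andP; split; first exact: Rintegral_ge0.
  rewrite /F /C /Rintegral fine_le//.
  - exact: integrable_fin_num (intfS _ _).
  - exact: integrable_fin_num.
  - apply: ge0_subset_integral => //.
    + by have /integrableP[] := intf.
    + by move=> y _; rewrite lee_fin.
exists (fun x => F x - F 0).
  by move=> x; apply: derivableB => //; case: (dF x).
split.
- apply/funext => x; have [dFx <-] := dF x.
  by rewrite !derive1E (deriveB dFx (derivable_cst _ _ _)) derive_cst subr0.
- by rewrite subrr.
- exists C => x; have /andP[? ?] := FC x; have /andP[? ?] := FC 0.
  by rewrite ler_norml; apply/andP; split; lra.
Qed.

Lemma bounded_of_support {R : realType} {f : R -> R} {a : R} :
    continuous f -> (forall x, a < `|x| -> f x = 0) ->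
  exists M : R, forall x, `|f x| <= M.
Proof.
move=> cf fa; have cnf : continuous (fun x => `|f x|).
  by move=> x; apply: cvg_norm; exact: cf.
have aa : - `|a| <= `|a| by rewrite -subr_ge0 opprK addr_ge0.
have [c _ fc] := EVT_max aa (continuous_subspaceT cnf).
exists `|f c| => x; have [xa|/fa ->] := leP `|x| a; last by rewrite normr0.
by apply: fc; rewrite in_itv/= -ler_norml (le_trans xa)// ler_norm.
Qed.

(** A continuous cutoff, so that its product with a continuous function has a
    primitive differentiable at every point. *)
Definition tent {R : realType} (a x : R) : R :=
  Num.max 0 (Num.min 1 (a + 1 - `|x|)).

Lemma tent_ge0 {R : realType} (a x : R) : 0 <= tent a x.
Proof. by rewrite /tent le_max lexx. Qed.

Lemma tent_le1 {R : realType} (a x : R) : tent a x <= 1.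
Proof. by rewrite /tent ge_max ler01 ge_min lexx. Qed.

Lemma tent_eq1 {R : realType} (a x : R) : `|x| <= a -> tent a x = 1.
Proof.
move=> xa; rewrite /tent min_l; last by lra.
by rewrite max_r.
Qed.

Lemma tent_eq0 {R : realType} (a x : R) : a + 1 < `|x| -> tent a x = 0.
Proof. by move=> xa; rewrite /tent max_l// ge_min subr_le0 (ltW xa) orbT. Qed.

Lemma tent_continuous {R : realType} (a : R) : continuous (tent a).
Proof.
move=> x.
have -> : tent a = cst 0 \max (cst 1 \min (fun z => a + 1 - `|z|)) by [].
apply: continuous_max; first exact: cvg_cst.
apply: continuous_min; first exact: cvg_cst.
by apply: cvgB; [exact: cvg_cst|apply: cvg_norm; exact: cvg_id].
Qed.

(** * The zero-bias identity and the Poincare inequality *)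

Lemma Lfun1_dominated {d : measure_display} {T : measurableType d}
    {R : realType} {P : probability T R} {X Y : T -> R} :
    measurable_fun setT X -> Y \in Lfun P 1%E -> (forall w, `|X w| <= `|Y w|) ->
  X \in Lfun P 1%E.
Proof.
move=> mX /Lfun1_integrable iY XY; apply/Lfun1_integrable.
apply: le_integrable iY => //; first exact/measurable_EFinP.
by move=> w _; rewrite /= lee_fin XY.
Qed.

(** For a continuous f of compact support, F and f are bounded, so both
    expectations of the zero-bias identity exist, and F is Lipschitz, hence
    absolutely continuous. *)
Lemma zero_biased_primitive {d : measure_display} {T : measurableType d}
    {R : realType} {P : probability T R} {W Wstar : {RV P >-> R}}
    {f : R -> R} {a : R} :
    (W : T -> R) \in Lfun P 1%E -> zero_biased W Wstar ->
    continuous f -> (forall x, 0 <= f x) -> (forall x, a < `|x| -> f x = 0) ->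
  exists2 F : R -> R, (forall x, derivable F x 1) &
    [/\ F^`()%classic = f, F 0 = 0 &
       ('E_P[fun w => (W w * F (W w))%R]
        = 'V_P[W] * 'E_P[fun w => f (Wstar w)])%E].
Proof.
move=> W1 zb cf f0 fa.
have mcomp (h : R -> R) (X : {RV P >-> R}) : continuous h ->
    measurable_fun setT (fun w => h (X w)).
  by move=> /continuous_measurable_fun mh; exact: measurableT_comp.
have [F dF [F'E F0 [M FM]]] := bounded_primitive f a cf f0 fa.
have [N fN] := bounded_of_support cf fa.
exists F => //; split=> //; rewrite -F'E; apply: zb.
- apply: (@lipschitz_abs_continuous R F N); apply: derivable_lipschitz => //.
  by rewrite F'E.
- apply: (@Lfun1_dominated _ _ _ _ _ (M \o* W)%R).
  + by apply: measurable_funM => //; apply/mcomp/derivable1_continuous.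
  + exact: Lfun_scale.
  + move=> w /=; rewrite !normrM ler_wpM2l//.
    by rewrite (le_trans (FM _))// ler_norm.
- rewrite F'E; apply: (@Lfun1_dominated _ _ _ _ _ (cst N)).
  + exact: mcomp.
  + exact: Lfun_cst.
  + by move=> w /=; rewrite (le_trans (fN _))// ler_norm.
Qed.

(** The mean minimizes the mean square distance. *)
Lemma variance_le_sqr {d : measure_display} {T : measurableType d}
    {R : realType} {P : probability T R} (X : T -> R) (c : R) :
  X \in Lfun P 2%:E -> ('V_P[X] <= 'E_P[fun w => ((X w - c) ^+ 2)%R])%E.
Proof.
move=> X2; rewrite -(varianceB_cst_r c X2) varianceE; last first.
  by rewrite rpredB ?lee1n//= => *; rewrite Lfun_cst.
apply: geeDl.
by rewrite oppe_le0 sqre_ge0.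
Qed.

(** The Poincare inequality, with the energy taken at the zero-biased variable.
    Both sides live in the extended reals, so that an infinite energy is
    allowed. *)
Lemma zero_biased_variance_le {d : measure_display} {T : measurableType d}
    {R : realType} {P : probability T R} {W Wstar : {RV P >-> R}} {g : R -> R} :
    (W : T -> R) \in Lfun P 1%E -> zero_biased W Wstar ->
    (forall x, derivable g x 1) -> continuous g^`()%classic ->
    (fun w => g (W w)) \in Lfun P 2%:E ->
  ('V_P[fun w => g (W w)]
   <= 'V_P[W] * 'E_P[fun w => (g^`()%classic (Wstar w) ^+ 2)%R])%E.
Proof.
move=> W1 zb dg cg' gW2.
have mW : measurable_fun setT W by [].
have mg : measurable_fun setT g.
  by apply: continuous_measurable_fun; exact: derivable1_continuous.
have mg' : measurable_fun setT g^`()%classic.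
  exact: continuous_measurable_fun.
apply: (le_trans (variance_le_sqr _ (g 0) gW2)).
rewrite [in X in (X <= _)%E]unlock.
pose D w := (((g (W w) - g 0) ^+ 2)%:E)%E.
have mD : measurable_fun setT D.
  apply/measurable_EFinP/measurable_funX/measurable_funB => //.
  exact: measurableT_comp.
pose A n := [set w | `|W w| <= n%:R]%classic.
have mA n : measurable (A n).
  have mN : measurable_fun setT (fun w => `|W w|) by exact: measurableT_comp.
  have -> : A n = (setT `&` (fun w => `|W w|) @^-1` `]-oo, n%:R])%classic.
    by rewrite setTI; apply/seteqP; split=> w /=; rewrite in_itv.
  by apply: mN => //; exact: measurable_itv.
have cupA : (\bigcup_n A n)%classic = setT.
  apply/seteqP; split=> // w _; exists (Num.trunc `|W w|).+1 => //=.
  by rewrite /A/= ltW// truncnS_gt.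
have cvgD :
    ((\int[P]_(w in A n) D w)%E @[n --> \oo] --> (\int[P]_w D w)%E)%classic.
  rewrite -cupA; apply: ge0_nondecreasing_set_cvg_integral => //.
  - move=> m n mn; rewrite subsetEset => w /= /le_trans; apply.
    by rewrite ler_nat.
  - by move=> n; exact: measurable_funTS.
  - by move=> n w _; rewrite lee_fin sqr_ge0.
(* It suffices to bound the expectation on each event |W| <= n. *)
rewrite -(cvg_lim (@ereal_hausdorff R) cvgD).
apply: lime_le; first by apply/cvg_ex; eexists; exact: cvgD.
apply: nearW => n.
pose f x := g^`()%classic x ^+ 2 * tent n%:R x.
have f0 x : 0 <= f x by rewrite mulr_ge0 ?sqr_ge0 ?tent_ge0.
have cf : continuous f.
  move=> x; apply: cvgM; last exact: tent_continuous.
  exact: cvgM (cg' x) (cg' x).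
have fa x : n%:R + 1 < `|x| -> f x = 0.
  by move=> /tent_eq0; rewrite /f => ->; rewrite mulr0.
have [F dF [F'E F0 EF]] := zero_biased_primitive W1 zb cf f0 fa.
(* F is nondecreasing and F(0) = 0, hence x F(x) >= 0: this is the
   Cauchy-Schwarz bound for a constant function. *)
have xF0 x : 0 <= x * F x.
  have := @sqr_increment_le R (cst 0) F x.
  rewrite subrr expr0n; apply=> // z _.
  by rewrite F'E derive1_cst expr0n.
have mWF : measurable_fun setT (fun w => W w * F (W w)).
  apply: measurable_funM => //; apply: measurableT_comp => //.
  by apply: continuous_measurable_fun; exact: derivable1_continuous.
apply: (@le_trans _ _ (\int[P]_(w in A n) (W w * F (W w))%:E)%E).
  apply: ge0_le_integral => //.
  - by move=> w _; rewrite lee_fin sqr_ge0.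
  - exact: measurable_funTS.
  - exact/measurable_funTS/measurable_EFinP.
  - move=> w /= Wn; rewrite lee_fin; apply: sqr_increment_le => // z zW.
    by rewrite F'E /f tent_eq1 ?mulr1// (le_trans zW).
apply: (@le_trans _ _ 'E_P[fun w => (W w * F (W w))%R]%E).
  rewrite unlock; apply: ge0_subset_integral => //.
  - exact/measurable_EFinP.
  - by move=> w _; rewrite lee_fin.
rewrite EF; apply: lee_wpmul2l; first exact: variance_ge0.
apply: expectation_le.
- by apply: measurableT_comp => //; exact: continuous_measurable_fun.
- by apply: measurable_funX; exact: measurableT_comp.
- by move=> w; exact: f0.
- by move=> w; exact: sqr_ge0.
- by apply: aeW => w /=; rewrite /f ler_piMr ?sqr_ge0 ?tent_le1.
Qed.

(** * The variance bound *)

Theorem proposition3p1 (d : measure_display) (T : measurableType d)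
    (R : realType) (P : probability T R) (W Wstar : {RV P >-> R})
    (W_L2 : (W : T -> R) \in Lfun P 2%:E)
    (W_mean0 : ('E_P[W] = 0)%E)
    (W_Wstar : zero_biased W Wstar)
    (g : R -> R)
    (g_diff : forall x : R, derivable g x 1)
    (g'_diff : forall x : R, derivable g^`()%classic x 1)
    (gW_L2 : (fun w => g (W w)) \in Lfun P 2%:E) :
  ('V_P[(fun w => g (W w))%R]
   <= 'V_P[W] * 'E_P[(fun w => g^`()%classic (W w) ^+ 2)%R]
      + 2%:E * 'V_P[W] * sup_norm (fun x => g^`()%classic x * g^`(2)%classic x)%R
        * 'E_P[(fun w => `|Wstar w - W w|)%R])%E.
Proof.
set g' := g^`()%classic.
have W1 : (W : T -> R) \in Lfun P 1%E.
  by apply: Lfun_subset12 W_L2; exact: fin_num_measure.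
have cg' : continuous g' by exact: derivable1_continuous.
have mg' : measurable_fun setT g' by exact: continuous_measurable_fun.
have mg'W (X : {RV P >-> R}) : measurable_fun setT (fun w => g' (X w) ^+ 2).
  by apply: measurable_funX; exact: measurableT_comp.
have mdist : measurable_fun setT (fun w => `|Wstar w - W w|).
  by apply: measurableT_comp => //; exact: measurable_funB.
have V0 : (0 <= 'V_P[W])%E by exact: variance_ge0.
have E0 : (0 <= 'E_P[fun w => `|Wstar w - W w|%R])%E by exact: expectation_ge0.
have EgW0 : (0 <= 'E_P[fun w => (g' (W w) ^+ 2)%R])%E.
  by apply: expectation_ge0 => w; exact: sqr_ge0.
apply: (le_trans (zero_biased_variance_le W1 W_Wstar g_diff cg' gW_L2)).
(* In the first two cases the error term is 0 even if the supremum is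
   infinite, because 0 * oo = 0. *)
have [E_eq0|E_neq0] := eqVneq ('E_P[fun w => `|Wstar w - W w|%R])%E 0%E.
  rewrite E_eq0 mule0 adde0; apply: lee_wpmul2l => //.
  apply: expectation_le => //; try by move=> w; exact: sqr_ge0.
  have : ae_eq P setT (fun w => (Wstar w - W w)%:E) (cst 0%E).
    apply/ae_eq_integral_abs => //.
      exact/measurable_EFinP/measurable_funB.
    by move: E_eq0; rewrite unlock.
  apply: filterS => w /(_ I)/= /eqP; rewrite eqe subr_eq0 => /eqP ->.
  by [].
have [V_eq0|V_neq0] := eqVneq ('V_P[W])%E 0%E.
  by rewrite V_eq0 mule0 !mul0e adde0.
case supE: (sup_norm _) => [K||]; last 2 first.
- rewrite [X in (_ + X)%E](_ : _ = +oo%E).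
    by rewrite addey ?leey// -ltNye (lt_le_trans _ (mule_ge0 V0 EgW0)).
  rewrite gt0_muley; last by rewrite mule_gt0 ?lte_fin// lt0e V_neq0.
  by rewrite gt0_mulye// lt0e E_neq0.
- have : ((`|g' 0 * g^`(2)%classic 0|)%:E
          <= sup_norm (fun x => g' x * g^`(2)%classic x)%R)%E.
    by apply: ereal_sup_ubound; exists 0.
  by rewrite supE leeNy_eq.
have gK x : `|g' x * g'^`()%classic x| <= K.
  by rewrite -lee_fin -supE; apply: ereal_sup_ubound; exists x.
have K0 : 0 <= K by apply: le_trans (gK 0).
have -> : (2%:E * 'V_P[W] * K%:E = 'V_P[W] * (2 * K)%:E)%E.
  by rewrite EFinM muleA [('V_P[W] * _)%E]muleC.
rewrite -muleA -ge0_muleDr//; last by rewrite mule_ge0// lee_fin mulr_ge0.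
apply: lee_wpmul2l => //.
apply: (@le_trans _ _
    ('E_P[fun w => (g' (W w) ^+ 2 + 2 * K * `|Wstar w - W w|)%R])%E).
  apply: expectation_le => //.
  - by apply: measurable_funD => //; exact: measurable_funM.
  - by move=> w; exact: sqr_ge0.
  - by move=> w; rewrite addr_ge0 ?sqr_ge0// mulr_ge0// mulr_ge0.
  - by apply: aeW => w; exact: sqr_derive1_increment_le.
rewrite unlock -ge0_integralZl//; last 2 first.
- exact/measurable_EFinP.
- by rewrite lee_fin mulr_ge0.
rewrite -ge0_integralD//.
- by move=> w _; rewrite lee_fin sqr_ge0.
- exact/measurable_EFinP.
- by move=> w _; rewrite -EFinM lee_fin mulr_ge0// mulr_ge0.
- by apply: measurable_funeM; exact/measurable_EFinP.
Qed.
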